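(* Let the inputs $u_0(\mathbf x;\mathbf a)$ and $u_b(\mathbf x,t;\mathbf a)$ satisfy the Lipschitz parameterization described in the context, and let $N$ pairs of input samples be collected, generated by $N$ independent realizations $\mathbf a^1,\dots,\mathbf a^N$ of the random parameter $\mathbf a\sim P^{\mathrm{true}}_{\mathbf a}$. Let $\rho_{\mathbf a}:=\mathrm{diam}(\mathrm{supp}(P^{\mathrm{true}}_{\mathbf a}))/2$ (diameter with respect to $\|\cdot\|_\infty$) and let $\bar{\mathbf a}\in\mathbb R^n$ be such that $\|\mathbf a-\bar{\mathbf a}\|_\infty\le\rho_{\mathbf a}$ for all $\mathbf a\in\mathrm{supp}(P^{\mathrm{true}}_{\mathbf a})$. Given a confidence level $1-\beta$, let $$\rho_0(\mathbf x):=L_0(\mathbf x)\,\epsilon_N(\beta,\rho_{\mathbf a}),\qquad \rho_b(\mathbf x,t):=L_b(\mathbf x,t)\,\epsilon_N(\beta,\rho_{\mathbf a}),$$ $$[\alpha_0(\mathbf x),\gamma_0(\mathbf x)]:=[u_0(\mathbf x;\bar{\mathbf a})-\sqrt n\,L_0(\mathbf x)\rho_{\mathbf a},\ u_0(\mathbf x;\bar{\mathbf a})+\sqrt n\,L_0(\mathbf x)\rho_{\mathbf a}],$$ $$[\alpha_b(\mathbf x,t),\gamma_b(\mathbf x,t)]:=[u_b(\mathbf x,t;\bar{\mathbf a})-\sqrt n\,L_b(\mathbf x,t)\rho_{\mathbf a},\ u_b(\mathbf x,t;\bar{\mathbf a})+\sqrt n\,L_b(\mathbf x,t)\rho_{\mathbf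 a}],$$ and define, for $\mathbf x\in\Omega$ and $(\mathbf x,t)\in\Gamma\times\mathbb R_{\ge0}$ respectively, the ambiguity sets $$\mathcal P^{0,\mathrm{Env}}_{\mathbf x}:=\Big\{F\in\mathcal{CD}(\mathbb R)\,\Big|\,\mathcal F^{\mathrm{low}}_{\rho_0(\mathbf x),[\alpha_0(\mathbf x),\gamma_0(\mathbf x)]}[\widehat F^N_{u_0(\mathbf x)}](U)\le F(U)\le\mathcal F^{\mathrm{up}}_{\rho_0(\mathbf x),[\alpha_0(\mathbf x),\gamma_0(\mathbf x)]}[\widehat F^N_{u_0(\mathbf x)}](U)\ \forall U\in\mathbb R\Big\},$$ $$\mathcal P^{b,\mathrm{Env}}_{\mathbf x,t}:=\Big\{F\in\mathcal{CD}(\mathbb R)\,\Big|\,\mathcal F^{\mathrm{low}}_{\rho_b(\mathbf x,t),[\alpha_b(\mathbf x,t),\gamma_b(\mathbf x,t)]}[\widehat F^N_{u_b(\mathbf x,t)}](U)\le F(U)\le\mathcal F^{\mathrm{up}}_{\rho_b(\mathbf x,t),[\alpha_b(\mathbf x,t),\gamma_b(\mathbf x,t)]}[\widehat F^N_{u_b(\mathbf x,t)}](U)\ \forall U\in\mathbb R\Big\}.$$ Then $$\mathbb P\Big(\big\{F^{\mathrm{true}}_{u_0(\mathbf x)}\in\mathcal P^{0,\mathrm{Env}}_{\mathbf x}\ \forall\mathbf x\in\Omega\big\}\cap\big\{F^{\mathrm{true}}_{u_b(\mathbf x,t)}\in\mathcal P^{b,\mathrm{Env}}_{\mathbf x,t}\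 \forall(\mathbf x,t)\in\Gamma\times\mathbb R_{\ge0}\big\}\Big)\ge1-\beta .$$
   Context: $\Omega\subset\mathbb R^d$ is a spatial domain with (upstream) boundary $\Gamma$. $u_0(\mathbf x;\mathbf a)$ ($\mathbf x\in\Omega$) and $u_b(\mathbf x,t;\mathbf a)$ ($\mathbf x\in\Gamma,t\ge0$) are real-valued initial and boundary data depending on a random parameter $\mathbf a$ with distribution $P^{\mathrm{true}}_{\mathbf a}$ supported on a compact subset of $\mathbb R^n$, and for all $\mathbf a,\mathbf a'\in\mathbb R^n$ (Euclidean norm) $|u_0(\mathbf x;\mathbf a)-u_0(\mathbf x;\mathbf a')|\le L_0(\mathbf x)\|\mathbf a-\mathbf a'\|$ for all $\mathbf x\in\Omega$, and $|u_b(\mathbf x,t;\mathbf a)-u_b(\mathbf x,t;\mathbf a')|\le L_b(\mathbf x,t)\|\mathbf a-\mathbf a'\|$ for all $\mathbf x\in\Gamma$, $t\ge0$, for continuous $L_0:\Omega\to\mathbb R_{\ge0}$, $L_b:\Gamma\times\mathbb R_{\ge0}\to\mathbb R_{\ge0}$. The $i$-th sample pair is $(u_0(\cdot;\mathbf a^i),u_b(\cdot,\cdot;\mathbf a^i))$; $\mathbb P$ refers to the samples. $F^{\mathrm{true}}_{u_0(\mathbf x)}$ and $F^{\mathrm{true}}_{u_b(\mathbf x,t)}$ are the CDFs of $u_0(\mathbf x;\mathbf a)$ and $u_b(\mathbf x,t;\mathbf a)$ for $\mathbf a\sim P^{\mathrm{true}}_{\mathbf a}$. $\widehat F^N_{u_0(\mathbf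 x)}$ and $\widehat F^N_{u_b(\mathbf x,t)}$ are the CDFs of the empirical distributions $\frac1N\sum_i\delta_{u_0(\mathbf x;\mathbf a^i)}$ and $\frac1N\sum_i\delta_{u_b(\mathbf x,t;\mathbf a^i)}$. $\mathcal{CD}(I)$ is the set of CDFs of scalar random variables with distribution supported on the interval $I$. $\epsilon_N(\beta,\rho)=\big(\ln(C\beta^{-1})/c\big)^{1/2}\rho N^{-1/2}$ if $n=1$; $\epsilon_N(\beta,\rho)=h^{-1}\big(\ln(C\beta^{-1})/(cN)\big)\rho$ if $n=2$, with $h^{-1}$ the inverse of $h(x)=x^2/[\ln(2+1/x)]^2$, $x>0$; $\epsilon_N(\beta,\rho)=\big(\ln(C\beta^{-1})/c\big)^{1/n}\rho N^{-1/n}$ if $n\ge3$. Here the constants $C,c$ depend only on $n$ and are those of the following known concentration result: if $X_1,\dots,X_N$ are i.i.d. in $\mathbb R^n$ with compactly supported law $\mu$, $\rho=\mathrm{diam}(\mathrm{supp}(\mu))/2$ (in $\|\cdot\|_\infty$) and $\widehat\mu^N=\frac1N\sum_i\delta_{X_i}$, then $\mathbb P(W_1(\widehat\mu^N,\mu)\le\epsilon_N(\beta,\rho))\ge1-\beta$, with $W_1$ the 1-Wasserstein distance for the Euclidean norm. **Envelopes.** For $F\in\mathcal{CD}([a,b])$ let $F^{-1}(y)=\inf\{t\in\mathbb R\,|\,F(t)>y\}$. For $0<\rho\le\min\{\int_a^bF(t)dt,\int_a^b(1-F(t))dt\}$ let $t^{\mathrm{up}}_\rho=\sup\{\tau\in[a,b]\,|\,\int_\tau^b(1-F(t))dt\ge\rho\}$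 and $t^{\mathrm{low}}_\rho=\inf\{\tau\in[a,b]\,|\,\int_a^\tau F(t)dt\ge\rho\}$. Then $\mathcal F^{\mathrm{up}}_{\rho,[a,b]}[F](t)$ equals $0$ for $t<a$; $\sup\{z\in[F(t),1]\,|\,\int_{F(t)}^z(F^{-1}(y)-t)dy\le\rho\}$ for $t\in[a,t^{\mathrm{up}}_\rho)$; $1$ for $t\ge t^{\mathrm{up}}_\rho$. And $\mathcal F^{\mathrm{low}}_{\rho,[a,b]}[F](t)$ equals $0$ for $t<t^{\mathrm{low}}_\rho$; $\inf\{z\in[0,F(t)]\,|\,\int_z^{F(t)}(t-F^{-1}(y))dy\le\rho\}$ for $t\in[t^{\mathrm{low}}_\rho,b)$; $1$ for $t\ge b$. *)

(* Defs.v *)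
From HB Require Import structures.
From mathcomp Require Import all_boot all_order all_algebra.
From mathcomp Require Import all_classical all_reals all_analysis.

Set Implicit Arguments.
Unset Strict Implicit.
Unset Printing Implicit Defensive.

Import Order.TTheory GRing.Theory Num.Theory.
Import numFieldNormedType.Exports.

Local Open Scope classical_set_scope.
Local Open Scope ring_scope.

(* R^n with its Borel sigma-algebra; the library puts no measurable structure
   on 'rV[R]_n itself. The norm `|x| on 'rV[R]_n is the sup norm. *)
Notation borel_rV R n := (g_sigma_algebraType (@open 'rV[R]_n)).

Definition enorm (R : realType) (n : nat) (v : 'rV[R]_n) : R :=
  Num.sqrt (\sum_(i < n) v ord0 i ^+ 2).

(* "E has probability at least p" for an event E that need not be measurable
   (for instance an uncountable intersection). *)
Definition prob_at_least d (T : measurableType d) (R : realType)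
    (P : probability T R) (p : R) (E : set T) : Prop :=
  exists A : set T, [/\ measurable A, A `<=` E & (p%:E <= P A)%E].

Definition mutually_independent d d' (T : measurableType d)
    (V : measurableType d') (R : realType) (P : probability T R) (N : nat)
    (X : 'I_N -> {RV P >-> V}) : Prop :=
  forall (J : {set 'I_N}) (A : 'I_N -> set V), (forall i, measurable (A i)) ->
    P (\bigcap_(i in [set` J]) (X i @^-1` A i)) =
    (\big[*%E/1]_(i in J) P (X i @^-1` A i))%E.

Definition iid_with_law d d' (T : measurableType d) (V : measurableType d')
    (R : realType) (P : probability T R) (N : nat)
    (X : 'I_N -> {RV P >-> V}) (mu : probability V R) : Prop :=
  (forall i A, measurable A -> distribution P (X i) A = mu A) /\
  mutually_independent X.

Definition empirical d (V : measurableType d) (R : realType) (N : nat)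
    (x : 'I_N -> V) : set V -> \bar R :=
  fun A => ((N%:R^-1)%:E * \sum_(i < N) \d_(x i) A)%E.

Definition msupport (R : realType) (n : nat) (mu : probability (borel_rV R n) R) :
    set 'rV[R]_n :=
  [set x | forall U : set 'rV[R]_n, open U -> U x -> (0 < mu U)%E].

Definition compactly_supported (R : realType) (n : nat)
    (mu : probability (borel_rV R n) R) : Prop :=
  exists K : set 'rV[R]_n, compact K /\ mu K = 1%E.

Definition half_diam (R : realType) (n : nat) (S : set 'rV[R]_n) : R :=
  sup [set `|x - y| | x in S & y in S] / 2.

Definition is_coupling d (V : measurableType d) (R : realType)
    (mu nu : set V -> \bar R) (pi : probability (V * V)%type R) : Prop :=
  forall A, measurable A ->
    pi (A `*` setT) = mu A /\ pi (setT `*` A) = nu A.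

Definition wasserstein1 (R : realType) (n : nat)
    (mu nu : set (borel_rV R n) -> \bar R) : \bar R :=
  ereal_inf
    [set (\int[pi]_z (enorm ((z.1 : 'rV[R]_n) - (z.2 : 'rV[R]_n)))%:E)%E
      | pi in [set pi | is_coupling mu nu pi]].

(* The inverse of h(x) = x^2 / ln(2 + 1/x)^2, an increasing bijection of the
   positive half-line; the default value 0 is the limit of the inverse at 0. *)
Definition h_inv (R : realType) (y : R) : R :=
  xget 0 [set x : R | 0 < x /\ x ^+ 2 / ln (2 + 1 / x) ^+ 2 = y].

Definition eps_radius (R : realType) (n N : nat) (C c beta rho : R) : R :=
  if n == 1%N then
    (ln (C * beta^-1) / c) `^ (1 / 2) * rho * N%:R `^ (- (1 / 2))
  else if n == 2%N then
    h_inv (ln (C * beta^-1) / (c * N%:R)) * rho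
  else
    (ln (C * beta^-1) / c) `^ (1 / n%:R) * rho * N%:R `^ (- (1 / n%:R)).

Definition concentration_constants (R : realType) (n : nat) (C c : R) : Prop :=
  [/\ 0 < C, 0 < c &
    forall d (T : measurableType d) (P : probability T R)
      (mu : probability (borel_rV R n) R) (N : nat)
      (X : 'I_N -> {RV P >-> borel_rV R n}) (beta : R),
    (0 < N)%N -> 0 < beta < 1 -> compactly_supported mu ->
    iid_with_law X mu ->
    prob_at_least P (1 - beta)
      [set w | (wasserstein1 (empirical R (fun i => X i w)) mu <=
                (eps_radius n N C c beta (half_diam (msupport mu)))%:E)%E]].

Definition dist_fun (R : realType) (m : set R -> \bar R) : R -> R :=
  fun t => fine (m `]-oo, t]%classic).

Definition CD (R : realType) (I : set R) : set (R -> R) :=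
  [set F | exists mu : probability R R, mu I = 1%E /\ F = dist_fun mu].

(* Real-valued: the infimum is over the empty set only for y >= 1 when F is a
   CDF, which contributes nothing to the integrals over [F t, z] and [z, F t]
   below, where z and F t lie in [0, 1]. *)
Definition gen_inv (R : realType) (F : R -> R) (y : R) : R :=
  inf [set t | y < F t].

(* Adjoining a (resp. b) changes nothing when rho is at most the integral of
   1 - F (resp. F) over [a, b], the set being then a nonempty subset of [a, b];
   for larger rho it makes the supremum (resp. infimum) of the empty subset of
   [a, b] equal to a (resp. b), so the envelope is the CDF of the point mass at
   a (resp. b). *)
Definition t_up (R : realType) (rho a b : R) (F : R -> R) : R :=
  sup (a |` [set tau | a <= tau <= b /\
    rho <= \int[lebesgue_measure]_(t in `[tau, b]) (1 - F t)]).

Definition t_low (R : realType) (rho a b : R) (F : R -> R) : R :=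
  inf (b |` [set tau | a <= tau <= b /\
    rho <= \int[lebesgue_measure]_(t in `[a, tau]) F t]).

Definition env_up (R : realType) (rho a b : R) (F : R -> R) (t : R) : R :=
  if t < a then 0
  else if t < t_up rho a b F then
    sup [set z | F t <= z <= 1 /\
      \int[lebesgue_measure]_(y in `[F t, z]) (gen_inv F y - t) <= rho]
  else 1.

Definition env_low (R : realType) (rho a b : R) (F : R -> R) (t : R) : R :=
  if t < t_low rho a b F then 0
  else if t < b then
    inf [set z | 0 <= z <= F t /\
      \int[lebesgue_measure]_(y in `[z, F t]) (t - gen_inv F y) <= rho]
  else 1.

Definition env_set (R : realType) (rho a b : R) (F : R -> R) : set (R -> R) :=
  [set G | CD setT G /\
    forall U : R, env_low rho a b F U <= G U <= env_up rho a b F U].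

(* Main.v *)
Require Import Defs.
From HB Require Import structures.
From mathcomp Require Import all_boot all_order all_algebra.
From mathcomp Require Import all_classical all_reals all_analysis.
From mathcomp Require Import measurable_realfun.
From mathcomp Require Import lra.

Set Implicit Arguments.
Unset Strict Implicit.
Unset Printing Implicit Defensive.

Import Order.TTheory GRing.Theory Num.Theory.
Import numFieldNormedType.Exports.

Local Open Scope classical_set_scope.
Local Open Scope ring_scope.

(** Put V := R^n and let x_1, ..., x_N be the samples. The concentration result
    provides an event A of probability at least 1 - beta on which the empirical
    law of the x_i is within Wasserstein distance eps of the true law Pa. This
    one event serves every location at once, and on it the rest of the argument
    is deterministic.

    Fix a location, let u be the data there as a function of the parameter, L
    its Lipschitz constant, and F and G the distribution functions of u under
    the empirical and the true law. If phi on R is 1-Lipschitz, then phi \o u is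
    L-Lipschitz, so integrating over almost optimal couplings gives
    E_F[phi] <= E_G[phi] + L * eps (lemma wasserstein1_dual). This is all that is
    retained of the Wasserstein bound.

    The envelope at t is then obtained from a single test function. Suppose
    F t < G t =: z, let Q be the quantile function of F and q := Q z. Take
    phi s := min (max (s - t, 0), q - t). Since Q carries the uniform law of
    [0, 1] to the law of F (lemma integral_quantile), E_F[phi] is the integral
    of phi (Q y) over 0 <= y <= 1, hence at least the integral of Q y - t over
    ]F t, z[, plus (q - t) * (1 - z). On the other hand phi <= q - t, and phi
    vanishes on ]-oo, t], so E_G[phi] <= (q - t) * (1 - z). Subtracting, the
    integral of Q y - t over ]F t, z[ is at most L * eps, which says that G t is
    one of the z over which the upper envelope takes its supremum. The lower
    envelope is the mirror image, and outside the range of t where the envelopes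
    are defined by such an extremum they are 0 or 1 for trivial reasons, because
    both laws live on the prescribed interval.

    That both laws live there follows from the Lipschitz bound once the
    parameter is known to lie almost surely in the sup-norm ball of radius rho_a
    around abar. For Pa this comes from compactness (lemma msupport_ball); the
    samples then lie in the ball with probability one, and intersecting A with
    this event leaves its probability unchanged. *)

(** * Distribution functions and quantiles on the line *)

Section DistFun.
Context {R : realType}.
Implicit Types (m : probability R R) (t : R).

Lemma dist_funE m t : ((dist_fun m t)%:E = m `]-oo, t]%classic)%E.
Proof. by rewrite /dist_fun fineK// fin_num_measure. Qed.

Lemma dist_fun_ge0 m t : 0 <= dist_fun m t.
Proof. by rewrite -lee_fin dist_funE. Qed.

Lemma dist_fun_le1 m t : dist_fun m t <= 1.
Proof. by rewrite -lee_fin dist_funE probability_le1. Qed.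

Lemma dist_fun_nondecreasing m : {homo dist_fun m : s t / s <= t}.
Proof.
move=> s t st; rewrite -lee_fin !dist_funE; apply: le_measure; rewrite ?inE//.
by apply: subset_itvl; rewrite bnd_simp.
Qed.

Lemma probability_ray m t : (m `]t, +oo[%classic = (1 - dist_fun m t)%:E)%E.
Proof.
by rewrite -setCitvl probability_setC// EFinB dist_funE.
Qed.

(** Open upper rays form a generating family stable under intersection, and
    the mass of each is read off from the distribution function. *)
Lemma dist_fun_inj (m1 m2 : probability R R) :
  dist_fun m1 = dist_fun m2 -> forall A, measurable A -> m1 A = m2 A.
Proof.
move=> F12 A mA.
apply: (measure_unique (@RGenOInfty.G R) (fun n => `]- n%:R, +oo[%classic)) => //.
- exact: RGenOInfty.measurableE.
- move=> _ _ [x ->] [y ->]; exists (Num.max x y).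
  by apply/seteqP; split=> z /=; rewrite !in_itv/= !andbT gt_max => /andP.
- by move=> n; exists (- n%:R).
- apply/seteqP; split=> [//|x _]; exists (Num.bound `|x|) => //=.
  rewrite in_itv/= andbT ltrNl.
  by rewrite (le_lt_trans _ (archi_boundP (normr_ge0 x)))// -normrN ler_norm.
- move=> _ [x ->]; transitivity ((1 - dist_fun m1 x)%:E); first exact: probability_ray.
  by rewrite F12; exact/esym/probability_ray.
- by move=> n; rewrite (le_lt_trans (probability_le1 _ _))// ltry.
Qed.

Section bounded_support.
Variables (m : probability R R) (a b : R).
Hypothesis m_ab : m `[a, b]%classic = 1%E.

Lemma supp_le : a <= b.
Proof.
rewrite leNgt; apply/negP => ba; move: m_ab.
rewrite set_itv_ge ?bnd_simp -?ltNge// measure0 => /eqP.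
by rewrite eqe eq_sym oner_eq0.
Qed.

Lemma dist_fun_lt t : t < a -> dist_fun m t = 0.
Proof.
move=> ta; apply: EFin_inj; rewrite dist_funE; apply/eqP; rewrite eq_le measure_ge0 andbT.
have <- : m (~` `[a, b]%classic) = 0%R%:E.
  by rewrite probability_setC// m_ab subee.
apply: le_measure; rewrite ?inE//; first exact: measurableC.
move=> s /=; rewrite !in_itv/= => st; apply/negP; rewrite negb_and -ltNge.
by rewrite (le_lt_trans st ta).
Qed.

Lemma dist_fun_ge t : b <= t -> dist_fun m t = 1.
Proof.
move=> bt; apply/eqP; rewrite eq_le dist_fun_le1/= -lee_fin dist_funE -m_ab.
apply: le_measure; rewrite ?inE//.
move=> s /=; rewrite !in_itv/= => /andP[_ sb]; exact: le_trans bt.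
Qed.

Local Notation F := (dist_fun m).

(** Right-continuity, in the only form needed: ]-oo, t] is the decreasing
    intersection of the rays ]-oo, t + 1/(k+1)]. *)
Lemma dist_fun_right t y : (forall s, t < s -> y <= F s) -> y <= F t.
Proof.
move=> H; rewrite -lee_fin dist_funE.
have cv : m `]-oo, (t + n.+1%:R^-1)]%classic @[n --> \oo] --> m `]-oo, t]%classic.
  have -> : `]-oo, t]%classic = \bigcap_n `]-oo, (t + n.+1%:R^-1)]%classic.
    apply/seteqP; split => [x /= xt n _|x /= xt].
      by move: xt; rewrite /= !in_itv/= => /le_trans; apply; rewrite lerDl invr_ge0.
    rewrite in_itv/=; apply/ler_addgt0Pr => e e0.
    have [n _ ne] := near_infty_natSinv_lt (PosNum e0).
    have /= := xt n I; rewrite in_itv/= => /le_trans; apply.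
    by rewrite lerD2l ltW//; apply: (ne n) => /=.
  apply: nonincreasing_cvg_mu => //.
  - by rewrite (le_lt_trans (probability_le1 _ _))// ltry.
  - exact: bigcapT_measurable.
  - move=> i j ij; apply/subsetPset; apply: subset_itvl; rewrite bnd_simp lerD2l.
    by rewrite lef_pV2 ?posrE// ler_nat.
rewrite -(cvg_lim _ cv)//; apply: lime_ge; first by apply/cvg_ex; eexists; exact: cv.
by near=> n; rewrite -dist_funE lee_fin; apply: H; rewrite ltrDl invr_gt0.
Unshelve. all: by end_near. Qed.

(** Clipping the generalized inverse outside ]0, 1[ makes it monotone on the
    whole line, hence measurable, with values in [a, b]; in particular it has
    sensible values at the levels 0 and 1, which the envelopes may reach. *)
Definition quantile (y : R) : R :=
  if y <= 0 then a else if 1 <= y then b else gen_inv F y.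

Let gen_inv_has_inf y : 0 <= y < 1 -> has_inf [set t | y < F t].
Proof.
move=> /andP[y0 y1]; split; first by exists b => /=; rewrite dist_fun_ge.
exists a => s /= yFs; rewrite leNgt; apply/negP => /dist_fun_lt Fs.
by move: yFs; rewrite Fs ltNge y0.
Qed.

Let gen_inv_itv y : 0 <= y < 1 -> a <= gen_inv F y <= b.
Proof.
move=> y01; apply/andP; split.
  apply: lb_le_inf; first by have [] := gen_inv_has_inf y01.
  move=> s /= yFs; rewrite leNgt; apply/negP => /dist_fun_lt Fs.
  by case/andP: y01 => y0; move: yFs; rewrite Fs ltNge y0.
apply: ge_inf; first by have [] := gen_inv_has_inf y01.
by rewrite /= dist_fun_ge//; case/andP: y01.
Qed.

Lemma quantile_nondecreasing : {homo quantile : x y / x <= y}.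
Proof.
move=> x y xy; rewrite /quantile.
have [y0|y0] := leP y 0; first by rewrite (le_trans xy y0).
have [x0|x0] := leP x 0; have [y1|y1] := leP 1 y.
- exact: supp_le.
- by have /andP[] := @gen_inv_itv y ltac:(lra).
- have [x1 //|x1] := leP 1 x.
  by have /andP[] := @gen_inv_itv x ltac:(lra).
- rewrite (leNgt 1 x) (le_lt_trans xy y1)/=.
  apply: lb_le_inf; first by have [] := @gen_inv_has_inf y ltac:(lra).
  move=> s /= yFs; apply: ge_inf; first by have [] := @gen_inv_has_inf x ltac:(lra).
  exact: le_lt_trans yFs.
Qed.

(** This lemma and the next are the two halves of the Galois connection between
    a distribution function and its quantiles; the level y = F s itself escapes
    the first half, which costs nothing since single points are null. *)
Lemma quantile_le y s : 0 <= y -> y < F s -> quantile y <= s.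
Proof.
move=> y0 ys; rewrite /quantile.
have y1 : y < 1 by rewrite (lt_le_trans ys)// dist_fun_le1.
rewrite (leNgt 1) y1/=; case: ifPn => [_|].
  rewrite leNgt; apply/negP => /dist_fun_lt Fs; move: ys; rewrite Fs; lra.
by move=> _; apply: ge_inf => //; have [] := @gen_inv_has_inf y ltac:(lra).
Qed.

Lemma le_dist_fun y s : y <= 1 -> quantile y <= s -> y <= F s.
Proof.
move=> y1; rewrite /quantile; have [y0 _|y0] := leP y 0.
  by rewrite (le_trans y0)// dist_fun_ge0.
have [y1' bs|y1' qs] := leP 1 y; first by rewrite dist_fun_ge.
apply: dist_fun_right => u su.
have [|v /= yv vu] := inf_lt _ (le_lt_trans qs su).
  by have [] := @gen_inv_has_inf y ltac:(lra).
by rewrite (le_trans (ltW yv))// dist_fun_nondecreasing// ltW.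
Qed.

Lemma measurable_quantile : measurable_fun [set: R] quantile.
Proof. by apply: nondecreasing_measurable => // x y; exact: quantile_nondecreasing. Qed.

Lemma quantile_gen_inv y : 0 < y < 1 -> quantile y = gen_inv F y.
Proof. by move=> /andP[y0 y1]; rewrite /quantile leNgt y0/= leNgt y1. Qed.

Let lambda := uniform_prob (@ltr01 R).

Let lambdaE (A : set R) : measurable A ->
  lambda A = lebesgue_measure (A `&` `[0, 1]%classic).
Proof.
move=> mA; have := @integral_uniform R 0 1 ltr01 (fun x => (\1_A x)%:E).
rewrite !integral_indic// setIT subr0 invr1 mul1e; apply.
  by apply/measurable_EFinP.
by move=> x; rewrite lee_fin.
Qed.

(** By the Galois connection the levels y in [0, 1] with quantile y <= s lie
    between [0, F s[ and [0, F s], and both have length F s. *)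
Let pushforward_quantile_ray s :
  pushforward lambda quantile `]-oo, s]%classic = m `]-oo, s]%classic.
Proof.
rewrite /pushforward lambdaE; last first.
  by rewrite -[X in measurable X]setTI; exact: measurable_quantile.
rewrite -dist_funE; apply/eqP; rewrite eq_le.
have mA : measurable (quantile @^-1` `]-oo, s]%classic `&` `[0, 1]%classic).
  apply: measurableI => //; rewrite -[X in measurable X]setTI.
  exact: measurable_quantile.
have F0 := dist_fun_ge0 m s; have F1 := dist_fun_le1 m s.
apply/andP; split.
- have -> : (F s)%:E = lebesgue_measure `[0, F s]%classic.
    rewrite lebesgue_measure_itv/= lte_fin; case: ltgtP F0 => // [_ _|<- _//].
    by rewrite -EFinB subr0.
  apply: le_measure; rewrite ?inE// => y /= [].
  by rewrite !in_itv/= => qs /andP[-> y1]; exact: le_dist_fun.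
- have -> : (F s)%:E = lebesgue_measure `[0, F s[%classic.
    rewrite lebesgue_measure_itv/= lte_fin; case: ltgtP F0 => // [_ _|<- _//].
    by rewrite -EFinB subr0.
  apply: le_measure; rewrite ?inE// => y /=.
  rewrite !in_itv/= => /andP[y0 ys]; rewrite quantile_le// y0.
  by split=> //; rewrite ltW// (lt_le_trans ys).
Qed.

(** Inverse transform sampling: a quantile function evaluated at a uniform
    random level has the prescribed law. *)
Lemma integral_quantile (phi : R -> R) : measurable_fun [set: R] phi ->
  (forall s, 0 <= phi s) ->
  (\int[m]_s (phi s)%:E =
   \int[lebesgue_measure]_(y in `[0%R, 1%R]) (phi (quantile y))%:E)%E.
Proof.
move=> mphi phi0.
have mQ := measurable_quantile.
pose mQ' := isMeasurableFun.Build _ _ (measurableTypeR R) R _ mQ.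
pose Q : {mfun measurableTypeR R >-> R} := HB.pack quantile mQ'.
pose m' := distribution lambda Q.
have mm' A : measurable A -> m A = m' A.
  apply: dist_fun_inj; apply/funext => s.
  by apply: EFin_inj; rewrite !dist_funE -pushforward_quantile_ray.
rewrite (@eq_measure_integral _ _ _ setT m'); last by move=> A mA _; exact: mm'.
rewrite ge0_integral_distribution//; last exact/measurable_EFinP.
rewrite integral_uniform; first by rewrite subr0 invr1 mul1e.
  by apply/measurable_EFinP; apply: measurableT_comp.
by move=> y; rewrite lee_fin.
Qed.

End bounded_support.
End DistFun.

(** * From one-sided duality to the envelopes *)

Section Envelope.
Context {R : realType}.
Implicit Types (s t w : R).

Definition clamp w s : R := Num.min (Num.max s 0) w.

Lemma clamp_ge0 w s : 0 <= w -> 0 <= clamp w s.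
Proof. by move=> w0; rewrite le_min le_max lexx orbT w0. Qed.

Lemma clamp_le w s : clamp w s <= w.
Proof. by rewrite ge_min lexx orbT. Qed.

Lemma clamp_id w s : 0 <= s <= w -> clamp w s = s.
Proof. by move=> /andP[s0 sw]; rewrite /clamp max_l// min_l. Qed.

Lemma clamp_top w s : 0 <= w -> w <= s -> clamp w s = w.
Proof. by move=> w0 ws; rewrite /clamp max_l ?(le_trans w0)// min_r. Qed.

Lemma clamp_bot w s : 0 <= w -> s <= 0 -> clamp w s = 0.
Proof. by move=> w0 s0; rewrite /clamp max_r// min_l. Qed.

Lemma clamp_lipschitz w s s' : `|clamp w s - clamp w s'| <= `|s - s'|.
Proof.
wlog ss : s s' / s <= s'.
  by move=> H; have [/H//|/ltW/H] := leP s s'; rewrite distrC (distrC s').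
rewrite /clamp; have [s0|s0] := leP s 0; have [s0'|s0'] := leP s' 0.
all: rewrite /Num.min; do !case: ifP => ?; rewrite (ler0_norm (x := s - s')) ?subr_le0//.
all: by rewrite ler_norml; lra.
Qed.

Lemma measurable_clamp w : measurable_fun [set: R] (clamp w).
Proof. by apply: measurable_minr => //; apply: measurable_maxr. Qed.

Lemma fine_le_EFin (x : \bar R) (r : R) : (0 <= x)%E -> (x <= r%:E)%E -> fine x <= r.
Proof. by case: x => [x| |]//=; rewrite ?lee_fin. Qed.

Variables (mu nu : probability R R) (a b rho : R).
Hypothesis mu_ab : mu `[a, b]%classic = 1%E.
Hypothesis nu_ab : nu `[a, b]%classic = 1%E.
Hypothesis dual : forall phi : R -> R, (forall s, 0 <= phi s) ->
  (forall s s', `|phi s - phi s'| <= `|s - s'|) ->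
  (\int[mu]_s (phi s)%:E <= \int[nu]_s (phi s)%:E + rho%:E)%E.

Local Notation F := (dist_fun mu).
Local Notation G := (dist_fun nu).
Local Notation Q := (quantile mu a b).

Let rho_ge0 : 0 <= rho.
Proof.
(* The duality bound for the zero function. *)
have := @dual (cst 0) ltac:(by []) ltac:(by move=> *; rewrite subrr normr0).
by rewrite !integral0 add0e lee_fin.
Qed.

Let mQ : measurable_fun [set: R] Q := measurable_quantile mu_ab.

(** The integrand is the horizontal gap between t and the quantiles of F, up to
    the level z = G t. Testing with the distance to the right of t, cut off at
    q = Q z, recovers the integral on the F side; the levels above z add
    exactly (q - t) * (1 - z) there, and this cancels, being an upper bound for
    the whole integral on the G side. *)
Lemma dist_fun_envelope_up t : F t <= G t ->
  \int[lebesgue_measure]_(y in `[F t, G t]) (gen_inv F y - t) <= rho.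
Proof.
rewrite le_eqVlt => /predU1P[<-|FG].
  by rewrite set_itv1 Rintegral_set1.
have F0 := dist_fun_ge0 mu t; have G1 := dist_fun_le1 nu t.
set z := G t in FG G1 *; set q := Q z.
have tq : t <= q.
  rewrite leNgt; apply/negP => qt; have := le_dist_fun mu_ab G1 (lexx q).
  rewrite leNgt => /negP; apply; rewrite (le_lt_trans _ FG)//.
  by rewrite dist_fun_nondecreasing// ltW.
have tQ y : F t < y -> y <= 1 -> t <= Q y.
  move=> Fy y1; rewrite leNgt; apply/negP => qt.
  have := le_dist_fun mu_ab y1 (lexx (Q y)).
  rewrite leNgt => /negP; apply; rewrite (le_lt_trans _ Fy)//.
  by rewrite dist_fun_nondecreasing// ltW.
pose phi s := clamp (q - t) (s - t).
have w0 : 0 <= q - t by rewrite subr_ge0.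
have phi0 s : 0 <= phi s by exact: clamp_ge0.
have mphi : measurable_fun [set: R] phi.
  by apply: measurableT_comp; [exact: measurable_clamp|exact: measurable_funB].
have phiL s s' : `|phi s - phi s'| <= `|s - s'|.
  by rewrite (le_trans (clamp_lipschitz _ _ _))// opprB addrA subrK.
have E2 : (\int[nu]_s (phi s)%:E <= ((q - t) * (1 - z))%:E)%E.
  rewrite EFinM -(probability_ray nu t) -[X in nu X]setIT -integral_indic//.
  rewrite -ge0_integralZl_EFin//; last exact/measurable_EFinP.
  apply: ge0_le_integral => [//||||s _].
  - by move=> s _; rewrite lee_fin.
  - by apply/measurable_EFinP.
  - by apply/measurable_EFinP; apply: measurable_funM.
  rewrite -EFinM lee_fin indicE mem_setE in_itv/= andbT.
  case: ltP => st; rewrite ?mulr1 ?mulr0 ?clamp_le//.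
  by rewrite /phi clamp_bot// subr_le0.
have mphiQ D : measurable_fun D (fun y => (phi (Q y))%:E).
  by apply/measurable_funTS/measurable_EFinP; apply: measurableT_comp.
have E1 : (\int[lebesgue_measure]_(y in `]F t, z[) (Q y - t)%:E + ((q - t) * (1 - z))%:E
    <= \int[mu]_s (phi s)%:E)%E.
  rewrite (integral_quantile mu_ab)//.
  apply: (@le_trans _ _ (\int[lebesgue_measure]_(y in `]F t, z[ `|` `[z, 1%R])
      (phi (Q y))%:E)%E).
    rewrite ge0_integral_setU//; last 3 first.
      exact: mphiQ.
      by move=> y _; rewrite lee_fin.
      rewrite disj_set2E; apply/eqP/seteqP; split=> y//= []; rewrite !in_itv/=; lra.
    rewrite leeD//.
      rewrite le_eqVlt; apply/orP; left; apply/eqP; apply: eq_integral => y.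
      rewrite inE/= in_itv/= => /andP[Fy yz].
      rewrite /phi clamp_id// subr_ge0 lerD2r.
      rewrite tQ//; last lra.
      by rewrite (quantile_nondecreasing mu_ab)// ltW.
    rewrite (eq_integral (cst (q - t)%:E)).
      rewrite integral_cst//= lebesgue_measure_itv/= lte_fin.
      have [z1|z1] := ltP z 1; first by rewrite -EFinB -EFinM.
      by rewrite (_ : z = 1) ?subrr ?mulr0 ?mule0//; lra.
    move=> y; rewrite inE/= in_itv/= => /andP[zy y1].
    by rewrite /phi clamp_top// lerD2r (quantile_nondecreasing mu_ab).
  apply: ge0_subset_integral => //; [exact: measurableU|exact: mphiQ| |].
    by move=> y _; rewrite lee_fin.
  by move=> y [] /=; rewrite !in_itv/=; lra.
(* Q and gen_inv F may differ at the level 0 or 1, so pass to the open interval. *)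
have E3 : (\int[lebesgue_measure]_(y in `[F t, z]) (gen_inv F y - t)%:E =
    \int[lebesgue_measure]_(y in `]F t, z[) (Q y - t)%:E)%E.
  have E4 y : y \in `]F t, z[%classic -> gen_inv F y = Q y.
    by rewrite inE/= in_itv/= => /andP[Fy yz]; rewrite quantile_gen_inv//; lra.
  rewrite integral_itv_bndoo.
    by apply: eq_integral => y /E4 ->.
  apply: (eq_measurable_fun (fun y => (Q y - t)%:E)) => [y /E4 -> //|].
  by apply/measurable_EFinP/measurable_funB => //; exact: measurable_funTS.
rewrite /Rintegral E3; apply: fine_le_EFin.
  apply: integral_ge0 => y /=; rewrite in_itv/= => /andP[Fy yz].
  by rewrite lee_fin subr_ge0 tQ//; lra.
rewrite -(@leeD2rE _ ((q - t) * (1 - z))%:E)// (le_trans E1)//.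
by rewrite (le_trans (dual phi0 phiL))// addeC leeD2l.
Qed.

(** Mirror image of the previous lemma: the test function is the distance to
    the left of t, cut off at the quantile of level z = G t, and the levels
    below z add (t - q) * z on the F side, which bounds the whole G side. *)
Lemma dist_fun_envelope_low t : G t <= F t ->
  \int[lebesgue_measure]_(y in `[G t, F t]) (t - gen_inv F y) <= rho.
Proof.
rewrite le_eqVlt => /predU1P[->|GF].
  by rewrite set_itv1 Rintegral_set1.
have G0 := dist_fun_ge0 nu t; have F1 := dist_fun_le1 mu t.
set z := G t in GF G0 *; set q := Q z.
have Qt y : 0 <= y -> y < F t -> Q y <= t by move=> y0 yF; exact: (quantile_le mu_ab).
have qt : q <= t by exact: Qt.
pose phi s := clamp (t - q) (t - s).
have w0 : 0 <= t - q by rewrite subr_ge0.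
have phi0 s : 0 <= phi s by exact: clamp_ge0.
have mphi : measurable_fun [set: R] phi.
  by apply: measurableT_comp; [exact: measurable_clamp|exact: measurable_funB].
have phiL s s' : `|phi s - phi s'| <= `|s - s'|.
  rewrite (le_trans (clamp_lipschitz _ _ _))// -normrN opprB opprB.
  by rewrite [X in `|X|](_ : _ = s - s')//; lra.
have E2 : (\int[nu]_s (phi s)%:E <= ((t - q) * z)%:E)%E.
  rewrite EFinM dist_funE -[X in nu X]setIT -integral_indic//.
  rewrite -ge0_integralZl_EFin//; last exact/measurable_EFinP.
  apply: ge0_le_integral => [//||||s _].
  - by move=> s _; rewrite lee_fin.
  - by apply/measurable_EFinP.
  - by apply/measurable_EFinP; apply: measurable_funM.
  rewrite -EFinM lee_fin indicE mem_setE in_itv/=.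
  have [st|st] := leP s t; rewrite ?mulr1 ?mulr0 ?clamp_le//.
  by rewrite /phi clamp_bot// subr_le0 ltW.
have mphiQ D : measurable_fun D (fun y => (phi (Q y))%:E).
  by apply/measurable_funTS/measurable_EFinP; apply: measurableT_comp.
have E1 : (\int[lebesgue_measure]_(y in `]z, F t[) (t - Q y)%:E + ((t - q) * z)%:E
    <= \int[mu]_s (phi s)%:E)%E.
  rewrite (integral_quantile mu_ab)//.
  apply: (@le_trans _ _ (\int[lebesgue_measure]_(y in `]z, F t[ `|` `[0%R, z])
      (phi (Q y))%:E)%E).
    rewrite ge0_integral_setU//; last 3 first.
      exact: mphiQ.
      by move=> y _; rewrite lee_fin.
      rewrite disj_set2E; apply/eqP/seteqP; split=> y//= []; rewrite !in_itv/=; lra.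
    rewrite leeD//.
      rewrite le_eqVlt; apply/orP; left; apply/eqP; apply: eq_integral => y.
      rewrite inE/= in_itv/= => /andP[zy yF].
      rewrite /phi clamp_id// subr_ge0 lerD2l lerN2.
      rewrite Qt//; last lra.
      by rewrite (quantile_nondecreasing mu_ab)// ltW.
    rewrite (eq_integral (cst (t - q)%:E)).
      rewrite integral_cst//= lebesgue_measure_itv/= lte_fin.
      have [z0|z0] := ltP 0 z; first by rewrite -EFinB -EFinM subr0.
      by rewrite (_ : z = 0) ?mulr0 ?mule0//; lra.
    move=> y; rewrite inE/= in_itv/= => /andP[y0 yz].
    by rewrite /phi clamp_top// lerD2l lerN2 (quantile_nondecreasing mu_ab).
  apply: ge0_subset_integral => //; [exact: measurableU|exact: mphiQ| |].
    by move=> y _; rewrite lee_fin.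
  by move=> y [] /=; rewrite !in_itv/=; lra.
(* Q and gen_inv F may differ at the level 0 or 1, so pass to the open interval. *)
have E3 : (\int[lebesgue_measure]_(y in `[z, F t]) (t - gen_inv F y)%:E =
    \int[lebesgue_measure]_(y in `]z, F t[) (t - Q y)%:E)%E.
  have E4 y : y \in `]z, F t[%classic -> gen_inv F y = Q y.
    by rewrite inE/= in_itv/= => /andP[zy yF]; rewrite quantile_gen_inv//; lra.
  rewrite integral_itv_bndoo.
    by apply: eq_integral => y /E4 ->.
  apply: (eq_measurable_fun (fun y => (t - Q y)%:E)) => [y /E4 -> //|].
  by apply/measurable_EFinP/measurable_funB => //; exact: measurable_funTS.
rewrite /Rintegral E3; apply: fine_le_EFin.
  apply: integral_ge0 => y /=; rewrite in_itv/= => /andP[zy yF].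
  by rewrite lee_fin subr_ge0 Qt//; lra.
rewrite -(@leeD2rE _ ((t - q) * z)%:E)// (le_trans E1)//.
by rewrite (le_trans (dual phi0 phiL))// addeC leeD2l.
Qed.

(** One-sided Kantorovich duality already forces the envelopes. When G t lies
    on the harmless side of F t, the value F t itself is the competitor that
    bounds the extremum. *)
Lemma dist_fun_env_set : env_set rho a b F G.
Proof.
split=> [|U]; first by exists nu; rewrite probability_setT.
have F0 := dist_fun_ge0 mu U; have F1 := dist_fun_le1 mu U.
have G0 := dist_fun_ge0 nu U; have G1 := dist_fun_le1 nu U.
apply/andP; split.
- rewrite /env_low; case: ifP => // _; case: ltP => [_|bU]; last first.
    by rewrite (dist_fun_ge nu_ab).
  have [GF|FG] := leP (G U) (F U).
    apply: ge_inf; first by exists 0 => z /= [/andP[]].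
    by rewrite /= G0 GF; split=> //; exact: dist_fun_envelope_low.
  rewrite (le_trans _ (ltW FG))//.
  apply: ge_inf; first by exists 0 => z /= [/andP[]].
  by rewrite /= F0 lexx set_itv1 Rintegral_set1.
- rewrite /env_up; case: ltP => [Ua|_]; first by rewrite (dist_fun_lt nu_ab).
  case: ifP => // _.
  have [FG|GF] := leP (F U) (G U).
    apply: ub_le_sup; first by exists 1 => z /= [/andP[]].
    by rewrite /= FG G1; split=> //; exact: dist_fun_envelope_up.
  rewrite (le_trans (ltW GF))//.
  apply: ub_le_sup; first by exists 1 => z /= [/andP[]].
  by rewrite /= F1 lexx set_itv1 Rintegral_set1.
Qed.

End Envelope.

(** * Borel sets, norms and supports in R^n *)

Section BorelRV.
Import finmap.
Context {R : realType} {n : nat}.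
Local Notation V := 'rV[R]_n.

Lemma open_borel (U : set V) : open U -> measurable (U : set (borel_rV R n)).
Proof. exact: sub_sigma_algebra. Qed.

Lemma closed_borel (U : set V) : closed U -> measurable (U : set (borel_rV R n)).
Proof.
by move=> cU; rewrite -[U]setCK; apply: measurableC; apply: open_borel; exact: closed_openC.
Qed.

Lemma continuous_borel (f : V -> R) :
  continuous f -> measurable_fun [set: borel_rV R n] f.
Proof.
move=> cf; apply: (measurability (@RGenOInfty.G R)).
  exact: RGenOInfty.measurableE.
move=> _ [_ [x ->] <-]; rewrite setTI; apply: open_borel; apply: open_comp.
  by move=> v _; exact: cf.
exact: rray_open.
Qed.

Lemma coord_le_norm (v : V) i : `|v ord0 i| <= `|v|.
Proof.
rewrite [leRHS]mx_normrE.
exact: (@le_bigmax _ _ _ 0 (fun ij => `|v ij.1 ij.2|) (ord0, i)).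
Qed.

Lemma enorm_le (v : V) : enorm v <= Num.sqrt n%:R * `|v|.
Proof.
rewrite -[ `|v| ]ger0_norm// -sqrtr_sqr -sqrtrM// ler_wsqrtr//.
rewrite mulrC mulr_natr -[X in _ *+ X]card_ord -sumr_const.
apply: ler_sum => i _; rewrite -real_normK ?num_real//.
by rewrite ler_sqr ?nnegrE// coord_le_norm.
Qed.

Lemma lipschitz_continuous (f : V -> R) L : 0 <= L ->
  (forall v v', `|f v - f v'| <= L * enorm (v - v')) -> continuous f.
Proof.
move=> L0 fL v; apply/(@cvgrPdist_lt R R^o _ (nbhs v) (nbhs_filter v)) => e e0.
pose K := L * Num.sqrt n%:R + 1.
have K0 : 0 < K by rewrite ltr_wpDl// mulr_ge0.
apply/(@nbhs_normP R 'rV[R]_n v); exists (e / K); first exact: divr_gt0.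
move=> w /= vw; rewrite (le_lt_trans (fL _ _))//.
rewrite (le_lt_trans (ler_wpM2l L0 (enorm_le _)))// mulrA.
rewrite ltr_pdivlMr// mulrC in vw; rewrite (le_lt_trans _ vw)//.
by rewrite ler_wpM2r// lerDl.
Qed.

(** Measurability has to come from the coordinates: the product of the two
    Borel sigma-algebras is not by definition the Borel one of the product. *)
Lemma measurable_enorm_sub :
  measurable_fun [set: borel_rV R n * borel_rV R n]
    (fun z => enorm ((z.1 : V) - (z.2 : V))).
Proof.
have mc i : measurable_fun [set: borel_rV R n] (fun v : V => v ord0 i).
  by apply: continuous_borel; exact: coord_continuous.
rewrite [X in measurable_fun _ X](_ : _ = Num.sqrt \o
    (fun z : borel_rV R n * borel_rV R n =>
      \sum_(i < n) ((z.1 : V) ord0 i - (z.2 : V) ord0 i) ^+ 2)); last first.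
  by apply/funext => z /=; congr Num.sqrt; apply: eq_bigr => i _; rewrite !mxE.
apply: measurableT_comp.
  by apply: continuous_measurable_fun; exact: sqrt_continuous.
apply: measurable_sum => i.
apply: measurable_funX; apply: measurable_funB.
  exact: (measurableT_comp (mc i) measurable_fst).
exact: (measurableT_comp (mc i) measurable_snd).
Qed.

Lemma continuous_dist (c : V) : continuous (fun v : V => `|v - c| : R).
Proof.
move=> v; apply/(@cvgrPdist_lt R R^o _ (nbhs v) (nbhs_filter v)) => e e0.
apply/(@nbhs_normP R 'rV[R]_n v); exists e => //= w vw.
rewrite (le_lt_trans _ vw)// (le_trans (ler_dist_dist _ _))//.
by rewrite opprB addrA subrK.
Qed.

Lemma closed_norm_ball (c : V) (r : R) : closed [set v : V | `|v - c| <= r].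
Proof.
apply: (@closed_comp _ _ (fun v : V => `|v - c|) [set x | x <= r]); last exact: closed_le.
by move=> v _; exact: continuous_dist.
Qed.

Lemma open_norm_ball (c : V) (r : R) : open [set v : V | `|v - c| < r].
Proof.
apply: (@open_comp _ _ (fun v : V => `|v - c|) [set x | x < r]); last exact: open_lt.
by move=> v _; exact: continuous_dist.
Qed.

Variable mu : probability (borel_rV R n) R.

(** Each point outside the support has a null open neighbourhood, and finitely
    many of these cover K. *)
Lemma negligible_compact (K : set V) : compact K ->
  K `&` msupport mu = set0 -> mu.-negligible K.
Proof.
move=> cK Ksupp.
have nullnbhs v : exists U : set V, ~ msupport mu v -> [/\ open U, U v & mu U = 0%E].
  have [sv|nsv] := pselect (msupport mu v); first by exists set0.
  move: nsv => /existsNP[U /not_implyP[oU /not_implyP[Uv muU]]].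
  exists U => _; split => //; apply/eqP; rewrite eq_le measure_ge0 andbT.
  by rewrite leNgt; exact/negP.
have [f fP] := choice nullnbhs.
have Kns v : K v -> ~ msupport mu v.
  by move=> Kv sv; have : (K `&` msupport mu) v by []; rewrite Ksupp.
move: cK; rewrite compact_cover => /(_ V K f)[| |D' D'K KD'].
- by move=> v /Kns /fP[].
- by move=> v Kv; exists v => //; have [] := fP _ (Kns _ Kv).
apply: (@negligibleS _ (borel_rV R n) R mu _ _ KD'); rewrite /cover bigcup_fset.
have D'0 v : v \in D' -> mu.-negligible (f v).
  move=> vD'; have /set_mem/Kns/fP[oU _ U0] := D'K _ vD'.
  by apply/(@negligibleP _ (borel_rV R n) R mu); [exact: open_borel|].
rewrite big_seq; elim/big_ind : _ => //; first exact: negligible_set0.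
by move=> A B; exact: (@negligibleU _ (borel_rV R n) R mu).
Qed.

(** Compactness stands in for second countability here. The points of a compact
    carrier of mu at distance at least r + 1/(k+1) from c form a compact
    set off the support, hence a null set, and their union over k contains all
    of the carrier outside the closed ball. *)
Lemma msupport_ball (c : V) (r : R) : compactly_supported mu ->
  (forall v, msupport mu v -> `|v - c| <= r) ->
  mu [set v : V | `|v - c| <= r] = 1%E.
Proof.
move=> [K [cK K1]] suppB; set B := [set v | _].
have mB : measurable (B : set (borel_rV R n)) by apply: closed_borel; exact: closed_norm_ball.
have mK : measurable (K : set (borel_rV R n)).
  by apply: closed_borel; apply: (compact_closed _ cK); exact: (@norm_hausdorff R 'rV[R]_n).
suff : mu.-negligible (~` B).
  move=> /(negligibleP mu (measurableC mB)) nB.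
  by rewrite -[B]setCK probability_setC ?nB ?sube0//; exact: measurableC.
pose A (k : nat) := ~` [set v : V | `|v - c| < r + k.+1%:R^-1].
apply: (@negligibleS _ (borel_rV R n) R mu (\bigcup_k A k)).
  move=> v /negP; rewrite -ltNge => /ltr_add_invr[k rk].
  by exists k => //=; apply/negP; rewrite -leNgt ltW.
apply: negligible_bigcup => k.
apply: (@negligibleS _ (borel_rV R n) R mu ((K `&` A k) `|` ~` K)).
  by move=> v Av; have [Kv|nKv] := pselect (K v); [left|right].
apply: negligibleU.
  apply: negligible_compact.
    apply: compact_closedI => //; apply: open_closedC; exact: open_norm_ball.
  rewrite -subset0 => v [[_ Av] /suppB vr]; apply: Av => /=.
  by rewrite (le_lt_trans vr)// ltrDl invr_gt0.
have nK : mu (~` K) = 0%E by rewrite probability_setC// K1 subee.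
by apply/(negligibleP mu (measurableC mK)).
Qed.

End BorelRV.

(** * Wasserstein distance and the image of a Lipschitz function *)

Section Wasserstein.
Context {R : realType} {n : nat}.
Local Notation V := (borel_rV R n).

(** The easy half of Kantorovich duality. The probability mu is the first
    marginal of one fixed coupling; it turns the set function m into something
    to integrate against. As the infimum over couplings need not be attained, an
    excess e / (L + 1) is let in and later absorbed. *)
Lemma wasserstein1_dual (m : set V -> \bar R) (nu : probability V R) (eps : R) :
  (wasserstein1 m nu <= eps%:E)%E ->
  exists mu : probability V R, (forall A, measurable A -> mu A = m A) /\
  forall (psi : V -> R) L, 0 <= L -> (forall v, 0 <= psi v) ->
    (forall v v' : 'rV[R]_n, `|psi v - psi v'| <= L * enorm (v - v')) ->
    (\int[mu]_v (psi v)%:E <= \int[nu]_v (psi v)%:E + (L * eps)%:E)%E.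
Proof.
move=> Weps.
have near_opt (e : R) : 0 < e -> exists2 pi : probability (V * V)%type R,
    is_coupling m nu pi &
    (\int[pi]_z (enorm ((z.1 : 'rV[R]_n) - (z.2 : 'rV[R]_n)))%:E < (eps + e)%:E)%E.
  move=> e0; have : (wasserstein1 m nu < (eps + e)%:E)%E.
    by rewrite (le_lt_trans Weps)// lte_fin ltrDl.
  by move=> /ereal_inf_lt[_ [pi piC <-] lt]; exists pi.
have mfst : measurable_fun [set: V * V] fst by exact: measurable_fst.
have msnd : measurable_fun [set: V * V] snd by exact: measurable_snd.
pose p1 : {mfun (V * V)%type >-> V} :=
  HB.pack (@fst V V) (isMeasurableFun.Build _ _ _ _ _ mfst).
pose p2 : {mfun (V * V)%type >-> V} :=
  HB.pack (@snd V V) (isMeasurableFun.Build _ _ _ _ _ msnd).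
have marg1 (pi : probability (V * V)%type R) A : is_coupling m nu pi -> measurable A ->
    distribution pi p1 A = m A.
  move=> piC mA; have [<- _] := piC A mA; congr (pi _).
  by apply/seteqP; split=> [z //=|z []].
have marg2 (pi : probability (V * V)%type R) A : is_coupling m nu pi -> measurable A ->
    distribution pi p2 A = nu A.
  move=> piC mA; have [_ <-] := piC A mA; congr (pi _).
  by apply/seteqP; split=> [z //=|z []].
have [pi0 pi0C _] := near_opt 1 ltr01.
exists (distribution pi0 p1); split; first by move=> A mA; exact: marg1.
move=> psi L L0 psi0 psiL; apply/lee_addgt0Pr => e e0.
have L1 : 0 < L + 1 by rewrite ltr_wpDl.
have [pi piC pi_lt] := near_opt (e / (L + 1)) (divr_gt0 e0 L1).
have mpsi : measurable_fun [set: V] psi.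
  by apply: continuous_borel; exact: lipschitz_continuous psiL.
rewrite (@eq_measure_integral _ _ _ setT (distribution pi p1)); last first.
  by move=> A mA _; apply: etrans (marg1 _ _ pi0C mA) _; exact/esym/marg1.
rewrite (@eq_measure_integral _ _ _ setT (distribution pi p2) nu); last first.
  by move=> A mA _; exact/esym/marg2.
have mE := @measurable_enorm_sub R n.
rewrite !ge0_integral_distribution//; try exact/measurable_EFinP.
apply: (@le_trans _ _ (\int[pi]_z ((psi z.2)%:E +
    L%:E * (enorm ((z.1 : 'rV[R]_n) - (z.2 : 'rV[R]_n)))%:E))%E).
  apply: ge0_le_integral => //.
  - by move=> z _; rewrite lee_fin.
  - by apply/measurable_EFinP; exact: measurableT_comp.
  - apply: emeasurable_funD; first by apply/measurable_EFinP; exact: measurableT_comp.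
    by apply: measurable_funeM; exact/measurable_EFinP.
  - move=> z _; rewrite -EFinM -EFinD lee_fin -lerBlDl.
    exact: le_trans (ler_norm _) (psiL _ _).
rewrite ge0_integralD//; last 4 first.
  - by move=> z _; rewrite lee_fin.
  - by apply/measurable_EFinP; exact: measurableT_comp.
  - by move=> z _; rewrite -EFinM lee_fin mulr_ge0// sqrtr_ge0.
  - by apply: measurable_funeM; exact/measurable_EFinP.
rewrite -(addeA _ (L * eps)%:E); apply: leeD; first exact: lexx.
rewrite ge0_integralZl_EFin//; last 2 first.
  - by move=> z _; rewrite lee_fin sqrtr_ge0.
  - exact/measurable_EFinP.
apply: (@le_trans _ _ (L%:E * (eps + e / (L + 1))%:E)%E).
  by apply: lee_wpmul2l; [rewrite lee_fin|exact: ltW].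
rewrite -EFinM -EFinD lee_fin mulrDr lerD2l mulrCA ler_piMr// ?ltW//.
by rewrite ltr_pdivrMr// mul1r ltrDl.
Qed.

Lemma empirical_pushforward (N : nat) (x : 'I_N -> V) (u : V -> R) (A : set R) :
  empirical R (fun i => u (x i)) A = empirical R x (u @^-1` A).
Proof. by []. Qed.

Lemma empirical1 (N : nat) (x : 'I_N -> V) (A : set V) : (0 < N)%N ->
  (forall i, A (x i)) -> empirical R x A = 1%E.
Proof.
move=> N0 Ax; rewrite /empirical (eq_bigr (fun=> 1%E)); last first.
  by move=> i _; rewrite diracE mem_set.
rewrite sumEFin sumr_const card_ord -EFinM mulVf//.
by rewrite pnatr_eq0 -lt0n.
Qed.

(** The deterministic core: the law of u under nu and the law of u under the
    sample satisfy the duality bound with constant L * eps, and both are carried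
    by an interval containing the image of the ball under u. *)
Lemma empirical_env_set (N : nat) (x : 'I_N -> V) (nu : probability V R)
    (c : 'rV[R]_n) (r eps : R) (u : 'rV[R]_n -> R) (L : R) :
  (0 < N)%N -> (forall i, `|(x i : 'rV[R]_n) - c| <= r) ->
  nu [set v : 'rV[R]_n | `|v - c| <= r] = 1%E ->
  0 <= L -> (forall v v', `|u v - u v'| <= L * enorm (v - v')) ->
  (wasserstein1 (empirical R x) nu <= eps%:E)%E ->
  env_set (L * eps) (u c - Num.sqrt n%:R * L * r) (u c + Num.sqrt n%:R * L * r)
    (dist_fun (empirical R (fun i => u (x i)))) (dist_fun (pushforward nu u)).
Proof.
move=> N0 xB nuB L0 uL /wasserstein1_dual[mu [muE dual]].
have mB : measurable ([set v : 'rV[R]_n | `|v - c| <= r] : set V).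
  by apply: closed_borel; exact: closed_norm_ball.
have mU : measurable_fun [set: V] u.
  by apply: continuous_borel; exact: lipschitz_continuous uL.
pose U : {mfun V >-> R} := HB.pack u (isMeasurableFun.Build _ _ _ _ _ mU).
have itv1 (m : probability V R) : m [set v : 'rV[R]_n | `|v - c| <= r] = 1%E ->
    distribution m U `[u c - Num.sqrt n%:R * L * r, u c + Num.sqrt n%:R * L * r]%classic = 1%E.
  move=> m1; apply/eqP; rewrite eq_le probability_le1//= -m1.
  apply: le_measure; [exact: mem_set mB|apply: mem_set; exact: (measurable_funPTI U)|].
  move=> v /= vr; rewrite in_itv/= -ler_distl (le_trans (uL _ _))//.
  rewrite (le_trans (ler_wpM2l L0 (enorm_le _)))// mulrA [L * _]mulrC.
  by rewrite ler_wpM2l// mulr_ge0.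
have -> : dist_fun (empirical R (fun i => u (x i))) = dist_fun (distribution mu U).
  apply/funext => t; rewrite /dist_fun empirical_pushforward -muE//.
  exact: (measurable_funPTI U).
apply: (@dist_fun_env_set R (distribution mu U) (distribution nu U)).
- by apply: itv1; rewrite muE// empirical1.
- exact: itv1.
- move=> phi phi0 phiL.
  have mphi : measurable_fun [set: R] phi.
    apply: continuous_measurable_fun => s; apply/cvgrPdist_lt => e e0.
    by apply/nbhs_normP; exists e => // s' /=; exact: le_lt_trans.
  rewrite !ge0_integral_distribution//; try exact/measurable_EFinP.
  apply: (dual (phi \o u) L L0) => [v|v v']; first exact: phi0.
  exact: le_trans (phiL _ _) (uL _ _).
Qed.

End Wasserstein.

(** * The confidence bound *)

Theorem corollary4p5
  (R : realType) (n : nat) (n_gt0 : (0 < n)%N)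
  (C c : R) (Cc : concentration_constants n C c)
  (dim : nat) (Omega Gamma : set 'rV[R]_dim)
  (Gamma_boundary : Gamma `<=` closure Omega `\` interior Omega)
  (u0 : 'rV[R]_dim -> 'rV[R]_n -> R)
  (ub : 'rV[R]_dim -> R -> 'rV[R]_n -> R)
  (L0 : 'rV[R]_dim -> R) (Lb : 'rV[R]_dim -> R -> R)
  (L0_continuous : {within Omega, continuous L0})
  (Lb_continuous : {within Gamma `*` [set t | 0 <= t],
     continuous (fun z : 'rV[R]_dim * R => Lb z.1 z.2)})
  (L0_ge0 : forall x, Omega x -> 0 <= L0 x)
  (Lb_ge0 : forall x t, Gamma x -> 0 <= t -> 0 <= Lb x t)
  (u0_lipschitz : forall (a a' : 'rV[R]_n) x, Omega x ->
     `|u0 x a - u0 x a'| <= L0 x * enorm (a - a'))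
  (ub_lipschitz : forall (a a' : 'rV[R]_n) x t, Gamma x -> 0 <= t ->
     `|ub x t a - ub x t a'| <= Lb x t * enorm (a - a'))
  (Pa : probability (borel_rV R n) R) (Pa_compact : compactly_supported Pa)
  (d : measure_display) (T : measurableType d) (P : probability T R)
  (N : nat) (N_gt0 : (0 < N)%N)
  (a : 'I_N -> {RV P >-> borel_rV R n}) (a_iid : iid_with_law a Pa)
  (abar : 'rV[R]_n)
  (abarP : forall v, msupport Pa v -> `|v - abar| <= half_diam (msupport Pa))
  (beta : R) (beta01 : 0 < beta < 1) :
  let rho_a := half_diam (msupport Pa) in
  let eps := eps_radius n N C c beta rho_a in
  let rho0 x := L0 x * eps in
  let rhob x t := Lb x t * eps in
  let alpha0 x := u0 x abar - Num.sqrt n%:R * L0 x * rho_a in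
  let gamma0 x := u0 x abar + Num.sqrt n%:R * L0 x * rho_a in
  let alphab x t := ub x t abar - Num.sqrt n%:R * Lb x t * rho_a in
  let gammab x t := ub x t abar + Num.sqrt n%:R * Lb x t * rho_a in
  let F0_true x := dist_fun (pushforward Pa (u0 x)) in
  let Fb_true x t := dist_fun (pushforward Pa (ub x t)) in
  let F0_hat w x := dist_fun (empirical R (fun i => u0 x (a i w))) in
  let Fb_hat w x t := dist_fun (empirical R (fun i => ub x t (a i w))) in
  let P0_env w x := env_set (rho0 x) (alpha0 x) (gamma0 x) (F0_hat w x) in
  let Pb_env w x t :=
    env_set (rhob x t) (alphab x t) (gammab x t) (Fb_hat w x t) in
  prob_at_least P (1 - beta)
    ([set w | forall x, Omega x -> P0_env w x (F0_true x)] `&`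
     [set w | forall x t, Gamma x -> 0 <= t -> Pb_env w x t (Fb_true x t)]).
Proof.
move=> rho_a eps rho0 rhob alpha0 gamma0 alphab gammab F0_true Fb_true F0_hat
  Fb_hat P0_env Pb_env.
have [_ _ conc] := Cc.
have [A [mA AW PA]] := conc d T P Pa N a beta N_gt0 beta01 Pa_compact a_iid.
pose B : set (borel_rV R n) := [set v : 'rV[R]_n | `|v - abar| <= rho_a].
have PaB : Pa B = 1%E by exact: msupport_ball.
have mB : measurable B by apply: closed_borel; exact: closed_norm_ball.
have [a_law a_indep] := a_iid.
(* The event that all samples fall in the ball. *)
pose S : set T := \bigcap_(i in [set` [set: 'I_N]%SET]) (a i @^-1` B).
have mS : measurable S.
  by apply: fin_bigcap_measurable => // i _; exact: (measurable_funPTI (a i)).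
have PS : P S = 1%E.
  rewrite /S (a_indep [set: 'I_N]%SET (fun=> B)) => [|i //].
  by rewrite big1// => i _; rewrite -PaB; exact: a_law.
exists (A `&` S); split; first exact: measurableI.
  move=> w [/AW Ww Sw].
  have Bw i : `|(a i w : 'rV[R]_n) - abar| <= rho_a by apply: (Sw i); rewrite /= inE.
  split=> [x Ox|x t Gx t0]; apply: empirical_env_set => //.
  - exact: L0_ge0.
  - by move=> v v'; exact: u0_lipschitz.
  - exact: Lb_ge0.
  - by move=> v v'; exact: ub_lipschitz.
rewrite (le_trans PA)//.
have nS : P (~` S) = 0%E by rewrite probability_setC// PS subee.
have -> : P A = (P (A `\` S) + P (A `&` S))%E by exact: measureDI.
rewrite [X in (X + _)%E](_ : _ = 0%E) ?add0e//.
apply/eqP; rewrite -measure_le0 -nS.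
apply: le_measure; [by apply: mem_set; exact: measurableD|by apply: mem_set; exact: measurableC|].
by move=> w [].
Qed.
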